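(* Let $V\subset L^2_\mu(D)$ be a subspace of finite complex dimension $N$ and $\mathcal L\in V^*$. Let $\widetilde V=\operatorname{span}\{V,\overline V\}$ be the conjugate closure of $V$, and let $\widetilde{\mathcal L}\in\widetilde V^*$ satisfy $\widetilde{\mathcal L}|_V=\mathcal L$. Assume that $(\mu,\rho,\widetilde V,\widetilde{\mathcal L})$ is relatively admissible and that $(\widetilde V,\widetilde{\mathcal L})$ is a nonnegative pair. Then there is a quadrature rule with at most $P=\dim_{\mathbb C}\widetilde V\le2N$ nodes in $D$, with positive weights, that is exact on $\widetilde V$ (i.e. $\sum_mw_mv(x_m)=\widetilde{\mathcal L}(v)$ for all $v\in\widetilde V$), and hence exact on $V$ (i.e. $\sum_mw_mv(x_m)=\mathcal L(v)$ for all $v\in V$).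
   Context: Setting. $\mu$ is a positive measure with closed support $D$ in a Banach space; functions on $D$ are $\mu$-measurable, complex-valued and pointwise defined. $\langle u,v\rangle=\int_D\overline{u}\,v\,d\mu$ and $\|\cdot\|$ are the inner product and norm of $L^2_\mu(D)$. $\overline V=\{\overline v:v\in V\}$. The following definitions are stated for a generic pair $(U,\mathcal F)$ and are applied to $(\widetilde V,\widetilde{\mathcal L})$: $U\subset L^2_\mu(D)$ is a finite-dimensional complex subspace; an $L^2_\mu$-orthonormal basis of $U$ is fixed, with fixed measurable pointwise representatives $\varphi_1,\dots,\varphi_P$, and $U$ is identified with the space of pointwise-defined functions $\sum_n c_n\varphi_n$ (with $V\subset\widetilde V$ as spaces of pointwise-defined functions). Write $k(x)=\sum_{n=1}^P|\varphi_n(x)|^2$. Sampling measure. $\tau^2:D\to[0,\infty)$ is measurable with $\int_D\tau^2\,d\mu=1$ and satisfies the coverage condition: $k(x)=0$ for $\mu$-almost every $x\in\{\tau^2=0\}$. $\rho$ is the probability measure $d\rho=\tau^2\,d\mu$, and $Q=\operatorname{ess\,sup}_{x\sim\rho}k(x)/\tau^2(x)$. Ratios of nonnegative quantities use the conventions $0/0=0$ and $a/0=+\infty$ for $a>0$. Functional. $\mathcal F\in U^*$ is a nonzero linear functional, $F\in U$ is its Riesz representer ($\mathcal F(v)=\langle F,v\rangle$ for $v\in U$), and $\|\mathcal F\|_{U^*}=\|F\|$. Relative admissibility. Let $\cos\gamma(x)=\frac{|F(x)|}{\|\mathcal F\|_{U^*}\sqrt{k(x)}}$ if $k(x)>0$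 and $\cos\gamma(x)=1$ if $k(x)=0$. Let $p_J=\Pr_{X\sim\rho}[1/\cos\gamma(X)\ge J^{1/2}]$. The tuple $(\mu,\rho,U,\mathcal F)$ is relatively admissible if $Q<\infty$ and $\lim_{J\to\infty}Jp_J=0$. Nonnegative pair. $U$ is closed under complex conjugation if $v\in U\Rightarrow\overline v\in U$; $U_{\mathbb R}=\{v\in U:v=\overline v\}$. $\mathcal F$ is real-preserving if $\mathcal F(v)\in\mathbb R$ for every $v\in U_{\mathbb R}$. $(U,\mathcal F)$ is a nonnegative pair if $U$ is closed under complex conjugation, $\mathcal F$ is real-preserving, and the Riesz representer $F$ admits a pointwise representative with $F(x)\ge0$ for all $x\in D$. *)

(* Defs.v *)
From HB Require Import structures.
From mathcomp Require Import all_boot all_order all_algebra.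
From mathcomp Require Import all_classical all_reals all_analysis.
From mathcomp Require Import ess_sup_inf complex.
Set Implicit Arguments.
Unset Strict Implicit.
Unset Printing Implicit Defensive.
Import Order.TTheory GRing.Theory Num.Theory numFieldNormedType.Exports.
Local Open Scope classical_set_scope.
Local Open Scope ring_scope.

(** A complex-valued function on a set [D] of points of [T] is represented by a
    total function [T -> R[i]] of which only the values on [D] matter: equality,
    spans, functionals and conjugation-invariance below are all taken on [D]. *)

Definition cmod (R : realType) (z : R[i]) : R := complex.Re `|z|.

(** [a / b] in the extended reals for nonnegative [a], [b], with
    [0 / 0 = 0] and [a / 0 = +oo] for [a > 0]. *)
Definition eratio (R : realType) (a b : R) : \bar R :=
  if b == 0 then (if a == 0 then 0%E else +oo%E) else (a / b)%:E.

Section FunctionsOnD.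
Context (d : measure_display) (T : measurableType d) (R : realType).
Variables (mu : {measure set T -> \bar R}) (D : set T).
Local Notation C := R[i].
Implicit Types (u v F : T -> C) (U V : set (T -> C)).

Definition eq_on u v := forall x, D x -> u x = v x.

Definition fconj u : T -> C := fun x => (u x)^*.

Definition cmeasurable u :=
  measurable_fun D (fun x => complex.Re (u x)) /\
  measurable_fun D (fun x => complex.Im (u x)).

Definition memL2 u :=
  cmeasurable u /\ (\int[mu]_(x in D) (cmod (u x) ^+ 2)%:E < +oo)%E.

Definition inner u v : C :=
  Complex (\int[mu]_(x in D) complex.Re ((u x)^* * v x))
          (\int[mu]_(x in D) complex.Im ((u x)^* * v x)).

Definition norm2 u : R := Num.sqrt (\int[mu]_(x in D) cmod (u x) ^+ 2).

Definition lin_comb n (c : 'I_n -> C) (f : 'I_n -> T -> C) : T -> C :=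
  fun x => \sum_(i < n) c i * f i x.

Definition fam_span n (f : 'I_n -> T -> C) : set (T -> C) :=
  [set v | exists c : 'I_n -> C, eq_on v (lin_comb c f)].

Definition lspan (A : set (T -> C)) : set (T -> C) :=
  [set v | exists n (c : 'I_n -> C) (f : 'I_n -> T -> C),
     (forall i, A (f i)) /\ eq_on v (lin_comb c f)].

Definition conj_closure V : set (T -> C) := lspan (V `|` [set fconj v | v in V]).

(** [V] is a subspace of L^2_mu(D) of complex dimension [n]; as in L^2,
    independence is modulo mu-almost everywhere equality on [D]. *)
Definition L2_subspace_dim n V :=
  exists psi : 'I_n -> T -> C,
    [/\ forall i, memL2 (psi i),
        forall c : 'I_n -> C,
          {ae mu, forall x, D x -> lin_comb c psi x = 0} -> forall i, c i = 0
      & V = fam_span psi].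

Definition orthonormal_basis n (phi : 'I_n -> T -> C) U :=
  [/\ forall i, memL2 (phi i),
      forall i j, inner (phi i) (phi j) = (i == j)%:R
    & U = fam_span phi].

Definition in_dual U (l : (T -> C) -> C) :=
  (forall u v, U u -> U v -> eq_on u v -> l u = l v) /\
  (forall (a : C) u v, U u -> U v ->
     l (fun x => a * u x + v x) = a * l u + l v).

Definition riesz_representer U (l : (T -> C) -> C) F :=
  U F /\ forall v, U v -> l v = inner F v.

Definition kfun n (phi : 'I_n -> T -> C) (x : T) : R :=
  \sum_(i < n) cmod (phi i x) ^+ 2.

Record sampling_measure n (phi : 'I_n -> T -> C) (tau2 : T -> R)
    (rho : probability T R) : Prop := SamplingMeasure {
  density_ge0 : forall x, D x -> 0 <= tau2 x;
  density_measurable : measurable_fun D tau2;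
  density_integral : (\int[mu]_(x in D) (tau2 x)%:E = 1)%E;
  density_coverage :
    {ae mu, forall x, D x -> tau2 x = 0 -> kfun phi x = 0};
  density_law : forall A, measurable A ->
    (rho A = \int[mu]_(x in A `&` D) (tau2 x)%:E)%E
}.

Definition Qconst n (phi : 'I_n -> T -> C) (tau2 : T -> R)
    (rho : probability T R) : \bar R :=
  ess_sup rho (fun x => eratio (kfun phi x) (tau2 x)).

Definition cosgamma n (phi : 'I_n -> T -> C) F (x : T) : R :=
  if 0 < kfun phi x then cmod (F x) / (norm2 F * Num.sqrt (kfun phi x)) else 1.

Definition pJ n (phi : 'I_n -> T -> C) F (rho : probability T R) (J : nat) :
    \bar R :=
  rho [set x | D x /\
    ((Num.sqrt J%:R)%:E <= eratio 1 (cosgamma phi F x))%E].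

(** [F] is determined on [D] by [l], because [phi] is orthonormal. *)
Definition relatively_admissible n (phi : 'I_n -> T -> C) (tau2 : T -> R)
    (rho : probability T R) (l : (T -> C) -> C) :=
  (Qconst phi tau2 rho < +oo)%E /\
  exists2 F, riesz_representer (fam_span phi) l F &
    (fun J : nat => (J%:R%:E * pJ phi F rho J)%E) @ \oo --> 0%E.

Definition conj_closed U := forall v, U v -> U (fconj v).

Definition real_preserving U (l : (T -> C) -> C) :=
  forall v, U v -> eq_on v (fconj v) -> l v \is Num.real.

(** In [R[i]], [0 <= z] means that [z] is a nonnegative real. *)
Definition nonnegative_pair U (l : (T -> C) -> C) :=
  [/\ conj_closed U, real_preserving U l
    & exists F F0 : T -> C,
        [/\ riesz_representer U l F, cmeasurable F0,
            {ae mu, forall x, D x -> F0 x = F x}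
          & forall x, D x -> 0 <= F0 x]].

End FunctionsOnD.

Definition quadrature (R : realType) (T : Type) M (x : 'I_M -> T) (w : 'I_M -> R)
    (v : T -> R[i]) : R[i] :=
  \sum_(m < M) (real_complex R (w m)) * v (x m).

(** The sigma-algebra is generated by any [G] containing the open sets, so that it
    may be the Borel one or a larger one such as the completion for the measure. *)
Definition closed_support (R : realType) (X : completeNormedModType R)
    (G : set (set X)) (mu : {measure set (g_sigma_algebraType G) -> \bar R}) :
    set X :=
  [set x | forall O : set X, open O -> O x -> (0 < mu O)%E].

(* Main.v *)
Require Import Defs.
From HB Require Import structures.
From mathcomp Require Import all_boot all_order all_algebra.
From mathcomp Require Import all_classical all_reals all_analysis.
From mathcomp Require Import complex measurable_realfun lra ring.
Set Implicit Arguments.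
Unset Strict Implicit.
Unset Printing Implicit Defensive.
Import Order.TTheory GRing.Theory Num.Theory numFieldNormedType.Exports.
Local Open Scope classical_set_scope.
Local Open Scope ring_scope.

(** By the Riesz representation, [Lt v] is the integral over [D] of [F0 v],
    where [F0 >= 0] is the nonnegative representative of the Riesz representer.
    So [Lt] is integration against the positive measure [F0 mu], and the claim is
    an instance of Tchakaloff's theorem: finitely many integrals against a
    positive measure can be reproduced by a positive combination of point
    evaluations.

    The vector of moments lies in the convex cone of point evaluations itself,
    not only in its closure ([tchakaloff]).  Otherwise a hyperplane separates it
    weakly from the cone ([cone_separation]): some nonzero linear combination
    [h] of the functions is nonnegative on [D] while its integral is at most
    [0].  Then [h = 0] almost everywhere for the measure, which therefore lives
    on the zero set of [h]; there one of the functions is a combination of the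
    others, and induction on their number applies.  The separation theorem needs
    no closedness: among the proper convex cones containing the given one, one
    whose lineality space has maximal dimension is a half-space or a hyperplane.

    Applied to the real and imaginary parts of an orthonormal basis this gives a
    rule with some number of nodes.  Nodes are then removed as in
    Caratheodory's theorem ([caratheodory]).  More than [P] vectors of values of
    the basis, in complex dimension [P], satisfy a nontrivial complex relation;
    since the space is closed under conjugation, the conjugate coefficients give
    a relation as well, hence so do the real and imaginary parts.  Moving the
    weights along a real relation until one of them vanishes removes a node, so
    [P] nodes suffice, rather than the [2 P] of the real count.

    Finally [P <= 2 N] because the basis is expressed, at every point of [D],
    through the [2 N] functions of a basis of [V] and their conjugates. *)

(** * Separation of convex cones in finite dimension *)

Section Cones.
Variables (R : realType) (n : nat).
Implicit Types (K : set 'rV[R]_n) (a b y : 'rV[R]_n).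

Definition convex_cone K :=
  [/\ K 0, forall y z, K y -> K z -> K (y + z)
    & forall t y, 0 <= t -> K y -> K (t *: y)].

Definition thicken K (W : 'M[R]_n) : set 'rV[R]_n :=
  [set y | exists k w, [/\ K k, (w <= W)%MS & y = k + w]].

Lemma thicken_cone K W : convex_cone K -> convex_cone (thicken K W).
Proof.
move=> [K0 KD KZ]; split.
- by exists 0, 0; rewrite sub0mx addr0.
- move=> _ _ [k [w [Kk wW ->]]] [k' [w' [Kk' wW' ->]]].
  exists (k + k'), (w + w'); rewrite addmx_sub //; split=> //; first exact: KD.
  by rewrite addrACA.
- move=> t _ t0 [k [w [Kk wW ->]]]; exists (t *: k), (t *: w).
  by rewrite scalemx_sub // scalerDr; split=> //; exact: KZ.
Qed.

Lemma thicken_sub K W y : K 0 -> (y <= W)%MS -> thicken K W y.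
Proof. by move=> K0 yW; exists 0, y; rewrite add0r. Qed.

Lemma thicken_adds K (W : 'M[R]_n) c y :
  thicken K (W + c)%MS y -> exists t : R, thicken K W (y - t *: c).
Proof.
move=> [k [_ [Kk /sub_addsmxP[[u v] /= ->] ->]]].
exists (v 0 0), k, (u *m W); rewrite submxMl; split=> //.
rewrite {1}[v]mx11_scalar mul_scalar_mx; apply/rowP => j; rewrite !mxE; ring.
Qed.

(** The step that enlarges the lineality space: a line can be added to [K]
    keeping it proper.  In the plane spanned by [a] and [b], the line through
    [b] with direction [a] leaves [K] at a boundary point [c], and adding the
    line spanned by such a [c] to [K] does not reach [a].  If [K] misses one of
    the two open half-planes bounded by the line spanned by [a], then that line
    can be added. *)
Lemma thicken_line K a b : convex_cone K -> ~ K a ->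
  exists c : 'rV[R]_n, (c = a \/ exists s : R, c = b + s *: a) /\
    exists e, forall t : R, ~ K (e - t *: c).
Proof.
move=> [K0 KD KZ] Ka.
have [[s Ks]|noS] := pselect (exists s : R, K (b + s *: a)); last first.
  exists a; split; first by left.
  by exists b => t Kt; apply: noS; exists (- t); rewrite scaleNr.
have [[s' Ks']|noS] := pselect (exists s : R, K (- b + s *: a)); last first.
  exists a; split; first by left.
  by exists (- b) => t Kt; apply: noS; exists (- t); rewrite scaleNr.
have posK t : K (t *: a) -> t <= 0.
  move=> Kt; rewrite leNgt; apply/negP => t0; apply: Ka.
  rewrite -[a]scale1r -(mulVf (lt0r_neq0 t0)) -scalerA.
  by apply: KZ => //; rewrite invr_ge0 ltW.
pose S := [set s : R | K (b + s *: a)].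
have supS : has_sup S.
  split; first by exists s.
  exists (- s') => u Su; rewrite -subr_le0 opprK; apply: posK.
  have -> : (u + s') *: a = (b + u *: a) + (- b + s' *: a).
    by apply/rowP => j; rewrite !mxE; ring.
  exact: KD.
exists (b + sup S *: a); split; first by right; exists (sup S).
exists a => t Kt.
have [t0|t0|t0] := ltgtP t 0; last by move: Kt; rewrite t0 scale0r subr0.
(* for [t < 0] a point of the line beyond the supremum would lie in [K] *)
- have : S (sup S - t^-1).
    rewrite /S /=.
    have -> : b + (sup S - t^-1) *: a = (- t)^-1 *: (a - t *: (b + sup S *: a)).
      by apply/rowP => j; rewrite !mxE; field; rewrite lt_eqF.
    by apply: KZ => //; rewrite invr_ge0 oppr_ge0 ltW.
  move=> /(ub_le_sup supS.2); rewrite gerBl invr_ge0; lra.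
(* for [t > 0] adding [t] times a point close to the supremum gives [a] *)
- have [u Su ut] := @sup_adherent _ S t^-1 ltac:(by rewrite invr_gt0) supS.
  have : K ((1 - t * sup S + t * u) *: a).
    have -> : (1 - t * sup S + t * u) *: a =
        (a - t *: (b + sup S *: a)) + t *: (b + u *: a).
      by apply/rowP => j; rewrite !mxE; ring.
    by apply: KD => //; apply: KZ => //; exact: ltW.
  move=> /posK; apply/negP; rewrite -ltNge.
  have : t * (sup S - t^-1) < t * u by rewrite ltr_pM2l.
  by rewrite mulrBr divff ?gt_eqF//; lra.
Qed.

(** No closedness is required.  Let [W] be a subspace of maximal dimension such
    that [K + W] is still proper, and let [e] be outside [K + W].  By
    [thicken_line] and maximality [W] and [e] span everything, so [W] is a
    hyperplane, and [K] lies on the side of [W] opposite to [e]. *)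
Lemma proper_cone_support K a : convex_cone K -> ~ K a ->
  exists c : 'cV[R]_n, c != 0 /\ forall y, K y -> 0 <= (y *m c) 0 0.
Proof.
move=> coneK Ka.
pose proper W := exists e, ~ thicken K W e.
pose Q r := `[< exists W, proper W /\ \rank W = r >].
have exQ : exists r, Q r.
  exists 0; apply/asboolP; exists 0; rewrite mxrank0; split=> //.
  exists a => -[k [w [Kk]]]; rewrite submx0 => /eqP -> ak.
  by apply: Ka; rewrite ak addr0.
have ubQ r : Q r -> (r <= n)%N.
  by move=> /asboolP[W [_ <-]]; exact: rank_leq_row.
case: (ex_maxnP exQ ubQ) => r /asboolP[W [[e We] rW]] maxr.
have coneW := thicken_cone W coneK.
have eW : ~~ (e <= W)%MS.
  by apply/negP => eW; apply: We; apply: thicken_sub => //; case: coneK.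
have nogrow (c : 'rV[R]_n) : ~~ (c <= W)%MS -> ~ proper (W + c)%MS.
  move=> cW pc; suff: (\rank (W + c)%MS <= \rank W)%N.
    rewrite (geq_leqif (mxrank_leqif_sup (addsmxSl W c))) addsmx_sub.
    by rewrite (negbTE cW) andbF.
  by rewrite rW; apply: maxr; apply/asboolP; exists (W + c)%MS.
(* otherwise some [b] is independent of [W] and [e], and [W] could grow *)
have fullW : row_full (W + e)%MS.
  rewrite -sub1mx; apply/row_subP => i; apply/negPn/negP => bW.
  set b := row i _ in bW.
  have [c [cab [f Hf]]] := thicken_line b coneW We.
  apply: (nogrow c); last first.
    by exists f => /thicken_adds[t]; exact: Hf.
  case: cab => [->//|[s ->]]; apply: contra bW => sW.
  rewrite -[b](addrK (s *: e)) addmx_sub //.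
    exact: submx_trans sW (addsmxSl _ _).
  by rewrite eqmx_opp scalemx_sub // addsmxSr.
have [k Wk ek] : exists2 k : 'M[R]_n, W *m k = 0 & e *m k != 0.
  by exists (cokermx W); rewrite ?mulmx_coker // -submxE.
have /rV0Pn[j ej] := ek.
(* normalised so that the functional [c] vanishes on [W] and is [-1] at [e] *)
pose c := - ((e *m k) 0 j)^-1 *: col j k.
have cW : W *m c = 0 by rewrite -scalemxAr colE mulmxA Wk mul0mx scaler0.
have ce : e *m c = (- 1)%:M.
  have cjE (M : 'rV[R]_n) : col j M = (M 0 j)%:M.
    by apply/matrixP => i l; rewrite !ord1 !mxE.
  rewrite -scalemxAr colE mulmxA -colE cjE scale_scalar_mx mulNr mulVf //.
exists c; split.
  apply/eqP => c0; move: ce; rewrite c0 mulmx0 => /matrixP/(_ 0 0).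
  by rewrite !mxE => /eqP; rewrite eq_sym oppr_eq0 oner_eq0.
move=> y Ky; have /sub_addsmxP[[u v] /= yE] := submx_full y fullW.
rewrite yE mulmxDl -!mulmxA cW ce mulmx0 add0r mul_mx_scalar !mxE.
rewrite mulN1r oppr_ge0 leNgt; apply/negP => v0; apply: We.
exists ((v 0 0)^-1 *: y), (- (v 0 0)^-1 *: (u *m W)).
have [_ _ KZ] := coneK; split.
- by apply: KZ => //; rewrite invr_ge0 ltW.
- by rewrite scalemx_sub // submxMl.
- rewrite yE {2}[v]mx11_scalar mul_scalar_mx scalerDr scalerA mulVf ?gt_eqF//.
  by rewrite scale1r scaleNr addrAC subrr add0r.
Qed.

(** This is [proper_cone_support] for the cone [K - R_+ a], which omits [a]
    because [a = k - t a] would give [a = k / (1 + t)]. *)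
Lemma cone_separation K a : convex_cone K -> ~ K a ->
  exists c : 'cV[R]_n,
    [/\ c != 0, forall y, K y -> 0 <= (y *m c) 0 0 & (a *m c) 0 0 <= 0].
Proof.
move=> [K0 KD KZ] Ka.
pose K' := [set y | exists k (t : R), [/\ K k, 0 <= t & y = k - t *: a]].
have coneK' : convex_cone K'.
  split.
  - by exists 0, 0; rewrite scale0r subr0.
  - move=> _ _ [k [t [Kk t0 ->]]] [l [u [Kl u0 ->]]].
    exists (k + l), (t + u); split; [exact: KD|exact: addr_ge0|].
    by rewrite scalerDl opprD addrACA.
  - move=> s _ s0 [k [t [Kk t0 ->]]]; exists (s *: k), (s * t).
    by split; [exact: KZ|exact: mulr_ge0|rewrite scalerBr scalerA].
have K'a : ~ K' a.
  move=> [k [t [Kk t0 ak]]]; apply: Ka.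
  have -> : a = (1 + t)^-1 *: k.
    rewrite -[k](subrK (t *: a)) -ak -{2}[a]scale1r -scalerDl scalerA.
    by rewrite mulVf ?scale1r // gt_eqF // ltr_pwDl.
  by apply: KZ => //; rewrite invr_ge0 addr_ge0.
have [c [c0 cK']] := proper_cone_support coneK' K'a.
exists c; split=> // [y Ky|].
  by apply: cK'; exists y, 0; rewrite scale0r subr0.
rewrite -oppr_ge0; have -> : - (a *m c) 0 0 = (- a *m c) 0 0.
  by rewrite mulNmx [RHS]mxE.
by apply: cK'; exists 0, 1; rewrite scale1r sub0r.
Qed.

End Cones.

(** * Tchakaloff's theorem *)

Section RintegralSum.
Context (d : measure_display) (T : measurableType d) (R : realType).
Variables (mu : {measure set T -> \bar R}) (D : set T).
Hypothesis mD : measurable D.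

Lemma integrable_lin_comb n (c : 'I_n -> R) (f : 'I_n -> T -> R) :
  (forall i, mu.-integrable D (EFin \o f i)) ->
  mu.-integrable D (EFin \o (fun x => \sum_i c i * f i x)).
Proof.
move=> If; rewrite (_ : EFin \o _ = fun x => (\sum_i (c i)%:E * (f i x)%:E)%E).
  by apply: integrable_sum => // i _; apply: integrableZl => //; exact: If.
by apply/funext => x /=; rewrite -sumEFin; apply: eq_bigr => i _; rewrite EFinM.
Qed.

Lemma Rintegral_lin_comb n (c : 'I_n -> R) (f : 'I_n -> T -> R) :
  (forall i, mu.-integrable D (EFin \o f i)) ->
  \int[mu]_(x in D) (\sum_i c i * f i x) =
    \sum_i c i * \int[mu]_(x in D) f i x.
Proof.
elim: n c f => [|n IHn] c f If.
  rewrite big_ord0 /Rintegral [X in fine X]integral0_eq //.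
  by move=> x _; rewrite big_ord0.
rewrite big_ord_recl.
rewrite -(IHn (fun i => c (lift ord0 i)) (fun i => f (lift ord0 i))) => [|i //].
rewrite -RintegralZl //.
rewrite -RintegralD //; last 2 first.
- by rewrite (_ : EFin \o _ = fun x => ((c ord0)%:E * (f ord0 x)%:E)%E) //;
    apply: integrableZl => //; exact: If.
- by apply: integrable_lin_comb => i; exact: If.
by apply: eq_Rintegral => x _; rewrite big_ord_recl.
Qed.

Lemma ae_eq_Rintegral (f g : T -> R) :
  measurable_fun D f -> measurable_fun D g ->
  {ae mu, forall x, D x -> f x = g x} ->
  \int[mu]_(x in D) f x = \int[mu]_(x in D) g x.
Proof.
move=> /measurable_EFinP mf /measurable_EFinP mg fg; congr fine.
apply: ae_eq_integral => //.
move: fg; apply: filterS.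
by move=> x /= fgx /fgx ->.
Qed.

Lemma Rintegral_le0_ae_eq0 (f : T -> R) :
  mu.-integrable D (EFin \o f) -> (forall x, D x -> 0 <= f x) ->
  \int[mu]_(x in D) f x <= 0 -> {ae mu, forall x, D x -> f x = 0}.
Proof.
move=> If f0 intf.
have mf := measurable_int _ If.
have : (\int[mu]_(x in D) `|(EFin \o f) x| = 0)%E.
  rewrite -(@eq_integral _ _ _ _ _ _ (EFin \o f)).
    rewrite -[LHS]fineK ?integrable_fin_num //; congr EFin.
    by apply/le_anti; rewrite intf Rintegral_ge0.
  by move=> x /set_mem Dx /=; rewrite ger0_norm // f0.
move/(ae_eq_integral_abs mu mD mf).
apply: filterS.
by move=> x + Dx => /(_ Dx)[].
Qed.

End RintegralSum.

Section Tchakaloff.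
Context (d : measure_display) (T : measurableType d) (R : realType).
Variables (mu : {measure set T -> \bar R}) (g : T -> R).

Definition evaluation_cone n (D : set T) (psi : 'I_n -> T -> R) :=
  [set y : 'rV[R]_n | exists M (x : 'I_M -> T) (w : 'I_M -> R),
    [/\ forall m, D (x m), forall m, 0 <= w m
      & forall i, \sum_m w m * psi i (x m) = y 0 i]].

Lemma evaluation_cone_convex n (D : set T) (psi : 'I_n -> T -> R) :
  convex_cone (evaluation_cone D psi).
Proof.
split.
- have x0 : 'I_0 -> T by case.
  by exists 0%N, x0, (fun=> 0); split=> [[]//|//|i]; rewrite big_ord0 mxE.
- move=> y z [M [x [w [Dx w0 wy]]]] [M' [x' [w' [Dx' w0' wz]]]].
  exists (M + M')%N, 
    (fun m => match fintype.split m with inl i => x i | inr j => x' j end).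
  exists (fun m => match fintype.split m with inl i => w i | inr j => w' j end).
  split=> [m|m|i]; try by case: fintype.split.
  rewrite mxE -wy -wz big_split_ord; congr (_ + _); apply: eq_bigr => m _.
    by rewrite (unsplitK (inl m)).
  by rewrite (unsplitK (inr m)).
- move=> t y t0 [M [x [w [Dx w0 wy]]]]; exists M, x, (fun m => t * w m).
  split=> [//|m|i]; first exact: mulr_ge0.
  by rewrite mxE -wy mulr_sumr; apply: eq_bigr => m _; rewrite mulrA.
Qed.

(** The density [g] plays the role of the positive measure [g mu]; keeping it
    explicit lets the induction shrink [D] while the measure stays the same. *)
Lemma tchakaloff n (D : set T) (psi : 'I_n -> T -> R) :
  measurable D -> measurable_fun D g -> (forall x, D x -> 0 <= g x) ->
  (forall i, measurable_fun D (psi i)) ->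
  (forall i, mu.-integrable D (EFin \o (fun x => g x * psi i x))) ->
  exists M (x : 'I_M -> T) (w : 'I_M -> R),
    [/\ forall m, D (x m), forall m, 0 <= w m
      & forall i, \sum_m w m * psi i (x m) = \int[mu]_(x in D) (g x * psi i x)].
Proof.
elim: n D psi => [|n IHn] D psi mD mg g0 mpsi Ipsi.
  have x0 : 'I_0 -> T by case.
  by exists 0%N, x0, (fun=> 0); split=> [[]|//|[]].
pose mom := \row_i \int[mu]_(x in D) (g x * psi i x).
have [[M [x [w [Dx w0 wE]]]]|momK] := pselect (evaluation_cone D psi mom).
  by exists M, x, w; split=> // i; rewrite wE mxE.
have [c [c0 cK cmom]] := cone_separation (evaluation_cone_convex D psi) momK.
pose h x := \sum_i c i 0 * psi i x.
have h0 x : D x -> 0 <= h x.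
  move=> Dx; have := cK (\row_i psi i x); rewrite mxE.
  rewrite (eq_bigr (fun i => c i 0 * psi i x)); last first.
    by move=> i _; rewrite mxE mulrC.
  apply; exists 1%N, (fun=> x), (fun=> 1); split=> // i.
  by rewrite big_ord1 mul1r mxE.
have gh x : g x * h x = \sum_i c i 0 * (g x * psi i x).
  by rewrite mulr_sumr; apply: eq_bigr => i _; rewrite mulrCA.
have mh : measurable_fun D h.
  by apply: measurable_sum => i; apply: measurable_funM.
have gh0 : {ae mu, forall x, D x -> g x * h x = 0}.
  apply: Rintegral_le0_ae_eq0 => //.
  - by under eq_fun do rewrite gh; exact: integrable_lin_comb.
  - by move=> x Dx; rewrite mulr_ge0 ?g0 ?h0.
  - under eq_Rintegral do rewrite gh.
    rewrite Rintegral_lin_comb //; apply: le_trans cmom.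
    by rewrite mxE; apply: ler_sum => i _; rewrite mxE mulrC.
(* [g mu] does not charge the complement of [D'] *)
pose D' := D `&` [set x | h x = 0].
have mD' : measurable D'.
  have := @measurable_eqe _ _ _ D mD (EFin \o h) (cst 0%E) _ _.
  rewrite (_ : D `&` _ = D'); last first.
    by apply/seteqP; split=> x [Dx] /= => [[]|->].
  by apply; [exact/measurable_EFinP|exact: measurable_cst].
have sD' : D' `<=` D by move=> x [].
have intD' i : \int[mu]_(x in D) (g x * psi i x) =
               \int[mu]_(x in D') (g x * psi i x).
  rewrite -(setIidr sD') Rintegral_mkcondr; apply: ae_eq_Rintegral => //.
  - exact: measurable_funM.
  - apply/measurable_restrict => //; rewrite (setIidr sD').
    apply: measurable_funM; first exact: measurable_funS mg.
    exact: measurable_funS (mpsi _).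
  move: gh0; apply: filterS.
  move=> x ghx Dx; rewrite patchE; case: ifPn => //.
  rewrite notin_setE => hx; have /eqP := ghx Dx.
  by rewrite mulf_eq0 => /orP[/eqP ->|/eqP hx0]; [rewrite mul0r|case: hx].
have /cV0Pn[k ck] := c0.
have [||||M [x [w [Dx w0 wE]]]] := IHn D' (fun j => psi (lift k j)) mD' _ _ _ _.
- exact: measurable_funS mg.
- by move=> x /sD'; exact: g0.
- by move=> j; apply: measurable_funS (mpsi _).
- by move=> j; apply: integrableS (Ipsi _).
exists M, x, w; split=> [m|//|i]; first exact: sD'.
(* on [D'] the relation [h = 0] eliminates the function of index [k] *)
have psik y : D' y -> psi k y =
    \sum_j (- (c k 0)^-1 * c (lift k j) 0) * psi (lift k j) y.
  move=> [_ /=]; rewrite /h (bigD1_ord k) //= => /eqP.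
  rewrite addr_eq0 => /eqP /(congr1 (fun z => (c k 0)^-1 * z)).
  rewrite mulrA mulVf // mul1r => ->; rewrite mulrN mulr_sumr -sumrN.
  by apply: eq_bigr => j _; rewrite mulNr mulrA mulNr.
have [j ->|->] := unliftP k i; first by rewrite wE intD'.
rewrite intD' (@eq_Rintegral _ _ _ mu D' (fun y => \sum_j
    (- (c k 0)^-1 * c (lift k j) 0) * (g y * psi (lift k j) y))); last first.
  move=> y /set_mem D'y; rewrite psik // mulr_sumr.
  by apply: eq_bigr => j _; rewrite mulrCA.
rewrite Rintegral_lin_comb //; last first.
  by move=> j; apply: integrableS (Ipsi _).
under eq_bigr do rewrite psik // mulr_sumr.
rewrite exchange_big /=; apply: eq_bigr => j _.
by rewrite -wE mulr_sumr; apply: eq_bigr => m _; rewrite mulrCA.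
Qed.

End Tchakaloff.

(** * Complex-valued integrals and the inner product *)

Section ComplexParts.
Variable R : realType.
Implicit Types z w : R[i].

Lemma complex_ext z w :
  complex.Re z = complex.Re w -> complex.Im z = complex.Im w -> z = w.
Proof. by case: z w => [a b] [a' b'] /= -> ->. Qed.

Lemma ReM z w : complex.Re (z * w) =
  complex.Re z * complex.Re w - complex.Im z * complex.Im w.
Proof. by case: z w => [a b] [a' b']. Qed.

Lemma ImM z w : complex.Im (z * w) =
  complex.Re z * complex.Im w + complex.Im z * complex.Re w.
Proof. by case: z w => [a b] [a' b']. Qed.

Lemma Re_real_mul (a : R) z :
  complex.Re (real_complex R a * z) = a * complex.Re z.
Proof. by case: z => b b' /=; rewrite mul0r subr0. Qed.

Lemma Im_real_mul (a : R) z :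
  complex.Im (real_complex R a * z) = a * complex.Im z.
Proof. by case: z => b b' /=; rewrite mul0r addr0. Qed.

Lemma Re_conj z : complex.Re z^* = complex.Re z.
Proof. by case: z. Qed.

Lemma Im_conj z : complex.Im z^* = - complex.Im z.
Proof. by case: z. Qed.

Lemma Re_sum n (f : 'I_n -> R[i]) :
  complex.Re (\sum_i f i) = \sum_i complex.Re (f i).
Proof. by apply: (big_morph (@complex.Re R)) => // -[? ?] [? ?]. Qed.

Lemma Im_sum n (f : 'I_n -> R[i]) :
  complex.Im (\sum_i f i) = \sum_i complex.Im (f i).
Proof. by apply: (big_morph (@complex.Im R)) => // -[? ?] [? ?]. Qed.

Lemma cmod2E z : cmod z ^+ 2 = complex.Re z ^+ 2 + complex.Im z ^+ 2.
Proof.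
rewrite /cmod normc_def /= sqr_sqrtr // addr_ge0 ?sqr_ge0 //.
Qed.

Lemma ge0_complexE z : 0 <= z -> 0 <= complex.Re z /\ complex.Im z = 0.
Proof. by rewrite lecE /= => /andP[/eqP -> ->]. Qed.

End ComplexParts.

Section ComplexIntegral.
Context (d : measure_display) (T : measurableType d) (R : realType).
Variables (mu : {measure set T -> \bar R}) (D : set T).
Hypothesis mD : measurable D.
Local Notation C := R[i].

Definition cintegrable (f : T -> C) :=
  mu.-integrable D (EFin \o (fun x => complex.Re (f x))) /\
  mu.-integrable D (EFin \o (fun x => complex.Im (f x))).

Definition cint (f : T -> C) : C :=
  Complex (\int[mu]_(x in D) complex.Re (f x))
          (\int[mu]_(x in D) complex.Im (f x)).

Lemma eq_cint (f g : T -> C) : eq_on D f g -> cint f = cint g.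
Proof.
by move=> fg; congr Complex; apply: eq_Rintegral => x /set_mem /fg ->.
Qed.

Lemma ae_eq_cint (f g : T -> C) : cmeasurable D f -> cmeasurable D g ->
  {ae mu, forall x, D x -> f x = g x} -> cint f = cint g.
Proof.
move=> [mf mf'] [mg mg'] fg; congr Complex; apply: ae_eq_Rintegral => //;
  by move: fg; apply: filterS => x + Dx => ->.
Qed.

Lemma ae_eq_cintegrable (f g : T -> C) : cmeasurable D g ->
  {ae mu, forall x, D x -> f x = g x} -> cintegrable f -> cintegrable g.
Proof.
move=> [mg mg'] fg [If If'].
have main (u v : T -> R) : measurable_fun D v ->
    {ae mu, forall x, D x -> u x = v x} ->
    mu.-integrable D (EFin \o u) -> mu.-integrable D (EFin \o v).
  move=> /measurable_EFinP mv uv /integrableP[mu_ Iu].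
  apply/integrableP; split=> //; apply: le_lt_trans Iu.
  rewrite le_eqVlt; apply/orP; left; apply/eqP.
  apply: ae_eq_integral => //; try exact: measurableT_comp.
  by move: uv; apply: filterS => x + Dx => /= ->.
by split; [apply: main If|apply: main If'] => //;
  move: fg; apply: filterS => x + Dx => ->.
Qed.

Let integrableB_real (u v : T -> R) : mu.-integrable D (EFin \o u) ->
  mu.-integrable D (EFin \o v) -> mu.-integrable D (EFin \o (u \- v)).
Proof. by move=> iu iv; exact: (integrableB mD iu iv). Qed.

Let integrableD_real (u v : T -> R) : mu.-integrable D (EFin \o u) ->
  mu.-integrable D (EFin \o v) -> mu.-integrable D (EFin \o (u \+ v)).
Proof. by move=> iu iv; exact: (integrableD mD iu iv). Qed.

Lemma cint_lin_comb n (c : 'I_n -> C) (f : 'I_n -> T -> C) :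
  (forall i, cintegrable (f i)) ->
  cintegrable (lin_comb c f) /\
  cint (lin_comb c f) = \sum_i c i * cint (f i).
Proof.
move=> If.
have IfR i := (If i).1; have IfI i := (If i).2.
have IRR (r : 'I_n -> R) := integrable_lin_comb mD r IfR.
have IRI (r : 'I_n -> R) := integrable_lin_comb mD r IfI.
have ReE : (fun x => complex.Re (lin_comb c f x)) =
    fun x => \sum_i complex.Re (c i) * complex.Re (f i x) -
             \sum_i complex.Im (c i) * complex.Im (f i x).
  apply/funext => x; rewrite Re_sum /= -sumrB.
  by apply: eq_bigr => i _; exact: ReM.
have ImE : (fun x => complex.Im (lin_comb c f x)) =
    fun x => \sum_i complex.Re (c i) * complex.Im (f i x) +
             \sum_i complex.Im (c i) * complex.Re (f i x).
  apply/funext => x; rewrite Im_sum /= -big_split.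
  by apply: eq_bigr => i _; exact: ImM.
split.
  by split; rewrite ?ReE ?ImE;
    [exact: integrableB_real|exact: integrableD_real].
apply: complex_ext; rewrite ?Re_sum ?Im_sum /= ?ReE ?ImE.
  rewrite RintegralB // !Rintegral_lin_comb //.
  by rewrite -sumrB; apply: eq_bigr => i _; rewrite ReM.
rewrite RintegralD // !Rintegral_lin_comb //.
by rewrite -big_split; apply: eq_bigr => i _; rewrite ImM.
Qed.

Lemma cmeasurableM (u v : T -> C) : cmeasurable D u -> cmeasurable D v ->
  cmeasurable D (fun x => (u x)^* * v x).
Proof.
move=> [mu1 mu2] [mv1 mv2]; split.
  under eq_fun do rewrite ReM Re_conj Im_conj mulNr opprK.
  by apply: measurable_funD; exact: measurable_funM.
under eq_fun do rewrite ImM Re_conj Im_conj mulNr.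
by apply: measurable_funB; exact: measurable_funM.
Qed.

(** Both parts are dominated by the sum of the squared moduli. *)
Lemma cintegrable_inner (u v : T -> C) : memL2 mu D u -> memL2 mu D v ->
  cintegrable (fun x => (u x)^* * v x).
Proof.
move=> [mu_ iu] [mv iv].
have i2 (w : T -> C) : cmeasurable D w ->
    (\int[mu]_(x in D) (cmod (w x) ^+ 2)%:E < +oo)%E ->
    mu.-integrable D (EFin \o (fun x => cmod (w x) ^+ 2)).
  move=> [m1 m2] iw; apply/integrableP; split.
    apply/measurable_EFinP; under eq_fun do rewrite cmod2E.
    by apply: measurable_funD; exact: measurable_funX.
  by under eq_integral do rewrite /= ger0_norm ?sqr_ge0//.
have i12 : mu.-integrable D (EFin \o
    ((fun x => cmod (u x) ^+ 2) \+ (fun x => cmod (v x) ^+ 2))).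
  by apply: integrableD_real; exact: i2.
have [m1 m2] := cmeasurableM mu_ mv.
have young (a b a' b' : R) :
    `|a * a' + b * b'| <= a ^+ 2 + b ^+ 2 + (a' ^+ 2 + b' ^+ 2).
  rewrite ler_norml; apply/andP; split.
    by have := sqr_ge0 (a + a'); have := sqr_ge0 (b + b'); nra.
  by have := sqr_ge0 (a - a'); have := sqr_ge0 (b - b'); nra.
split; apply: le_integrable i12 => //; try exact/measurable_EFinP;
  move=> x Dx /=; rewrite lee_fin !cmod2E [leRHS]ger0_norm ?addr_ge0 ?sqr_ge0 //.
  by rewrite ReM Re_conj Im_conj mulNr opprK.
rewrite ImM Re_conj Im_conj mulNr -mulrN.
by apply: le_trans (young _ _ _ _) _; rewrite sqrrN lerD2l addrC.
Qed.

Lemma inner_lin_combr n (c : 'I_n -> C) (f : 'I_n -> T -> C) u :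
  (forall i, cintegrable (fun x => (u x)^* * f i x)) ->
  inner mu D u (lin_comb c f) = \sum_i c i * inner mu D u (f i).
Proof.
move=> If; rewrite -[RHS](cint_lin_comb c If).2; apply: eq_cint => x Dx.
by rewrite /lin_comb mulr_sumr; apply: eq_bigr => i _; rewrite mulrCA.
Qed.

Lemma cintegrable_span_inner n (f : 'I_n -> T -> C) u v :
  (forall i, memL2 mu D (f i)) -> fam_span D f u -> memL2 mu D v ->
  cintegrable (fun x => (u x)^* * v x).
Proof.
move=> f2 [c uE] v2.
have If i : cintegrable (fun x => (f i x)^* * v x) by exact: cintegrable_inner.
have [I1 I2] := (cint_lin_comb (fun i => (c i)^*) If).1.
have E x : D x -> lin_comb (fun i => (c i)^*) (fun i x => (f i x)^* * v x) x =
    (u x)^* * v x.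
  move=> Dx; rewrite uE // /lin_comb rmorph_sum mulr_suml.
  by apply: eq_bigr => i _; rewrite rmorphM mulrA.
by split; [apply: eq_integrable I1|apply: eq_integrable I2] => //
  x /set_mem Dx /=; rewrite E.
Qed.

End ComplexIntegral.

(** * Reducing the number of nodes *)

Lemma left_kernel (F : fieldType) m n (A : 'M[F]_(m, n)) : (n < m)%N ->
  exists2 v : 'rV_m, v != 0 & v *m A = 0.
Proof.
move=> nm; have : kermx A != 0.
  rewrite kermx_eq0 -row_leq_rank -ltnNge.
  exact: leq_ltn_trans (rank_leq_col A) nm.
by case/rowV0Pn => v vA v0; exists v => //; exact/sub_kermxP.
Qed.

Section Caratheodory.
Variables (R : realType) (T : Type) (P : nat) (phi : 'I_P -> T -> R[i]).

Definition nonneg_rule (D : set T) (l : 'I_P -> R[i]) M (x : 'I_M -> T)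
    (w : 'I_M -> R) :=
  [/\ forall m, D (x m), forall m, 0 <= w m
    & forall i, quadrature x w (phi i) = l i].

Lemma drop_null_node D l M (x : 'I_M.+1 -> T) w k :
  nonneg_rule D l x w -> w k = 0 ->
  nonneg_rule D l (fun m => x (lift k m)) (fun m => w (lift k m)).
Proof.
move=> [Dx w0 wl] wk; split=> // i.
by rewrite -wl /quadrature (bigD1_ord k) //= wk rmorph0 mul0r add0r.
Qed.

(** Subtracting [t e] from the weights keeps the rule exact; the largest [t]
    that keeps them nonnegative is the least ratio [w m / e m] over [e m > 0],
    and it annihilates the weight that attains it. *)
Lemma move_along_relation D l M (x : 'I_M -> T) w (e : 'I_M -> R) :
  nonneg_rule D l x w -> (exists m, 0 < e m) ->
  (forall i, quadrature x e (phi i) = 0) ->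
  exists w' : 'I_M -> R, nonneg_rule D l x w' /\ exists k, w' k = 0.
Proof.
move=> [Dx w0 wl] [m0 em0] e0.
have [k ek mink] :=
  @arg_minP _ _ _ m0 (fun m => 0 < e m) (fun m => w m / e m) em0.
exists (fun m => w m - w k / e k * e m); split; last first.
  by exists k; rewrite divfK ?subrr // gt_eqF.
split=> // [m|i].
  rewrite subr_ge0; have [em|em] := ltP 0 (e m).
    by rewrite -ler_pdivlMr // mink.
  by apply: le_trans (w0 m); rewrite mulr_ge0_le0 // divr_ge0 // ltW.
rewrite -wl -[RHS]subr0 -[X in _ - X](mulr0 (w k / e k)%:C%C) -(e0 i).
rewrite /quadrature mulr_sumr -sumrB; apply: eq_bigr => m _.
by rewrite rmorphB rmorphM mulrBl mulrA.
Qed.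

(** A complex relation [v] between the vectors of values exists for reasons of
    dimension.  Conjugating it, and rewriting the conjugates of the [phi i]
    through the [phi j], shows that the conjugate of [v] is a relation too; so
    are the real and the imaginary part of [v], and one of them is nonzero. *)
Lemma real_relation (D : set T) M (x : 'I_M -> T) :
  (forall i, exists b : 'I_P -> R[i],
     forall y, D y -> (phi i y)^* = \sum_j b j * phi j y) ->
  (forall m, D (x m)) -> (P < M)%N ->
  exists2 e : 'I_M -> R, exists m, 0 < e m
    & forall i, quadrature x e (phi i) = 0.
Proof.
move=> conjphi Dx PM.
have [v v0 vA] := left_kernel (\matrix_(m < M, i < P) phi i (x m)) PM.
have vphi i : \sum_m v 0 m * phi i (x m) = 0.
  have := congr1 (fun A : 'rV_P => A 0 i) vA; rewrite !mxE => {2}<-.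
  by apply: eq_bigr => m _; rewrite mxE.
have vJphi i : \sum_m (v 0 m)^* * phi i (x m) = 0.
  have [b bE] := conjphi i.
  apply: (can_inj conjCK); rewrite rmorph0 rmorph_sum.
  under eq_bigr => m _ do rewrite rmorphM /= conjCK bE // mulr_sumr.
  rewrite exchange_big big1 // => j _.
  under eq_bigr do rewrite mulrCA.
  by rewrite -mulr_sumr vphi mulr0.
have rele (e : 'I_M -> R) : (exists m, e m != 0) ->
    (forall i, quadrature x e (phi i) = 0) ->
    exists2 e : 'I_M -> R, exists m, 0 < e m
      & forall i, quadrature x e (phi i) = 0.
  move=> [m em] eq0; have [em_gt0|em_le0] := ltP 0 (e m).
    by exists e => //; exists m.
  exists (fun m => - e m); first by exists m; rewrite oppr_gt0 lt_neqAle em.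
  move=> i; rewrite -oppr0 -(eq0 i) /quadrature -sumrN.
  by apply: eq_bigr => k _; rewrite rmorphN mulNr.
have /rV0Pn[m vm] := v0.
have [Re0|Re0] := eqVneq (complex.Re (v 0 m)) 0.
  apply: (rele (fun m => complex.Im (v 0 m))).
    exists m; apply: contra_neq vm => Im0; exact: complex_ext.
  move=> i; apply: (@mulfI _ (2%:R * 'i)).
    by rewrite mulf_neq0 ?neq0Ci // pnatr_eq0.
  rewrite mulr0; transitivity (\sum_m v 0 m * phi i (x m) -
      \sum_m (v 0 m)^* * phi i (x m)); last by rewrite vphi vJphi subrr.
  rewrite /quadrature mulr_sumr -sumrB; apply: eq_bigr => k _.
  rewrite -mulrBl mulrA; congr (_ * _); case: (v 0 k) => a b.
  by rewrite -complexiE; apply: complex_ext => /=; ring.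
apply: (rele (fun m => complex.Re (v 0 m))); first by exists m.
move=> i; apply: (@mulfI _ 2%:R); first by rewrite pnatr_eq0.
rewrite mulr0; transitivity (\sum_m v 0 m * phi i (x m) +
    \sum_m (v 0 m)^* * phi i (x m)); last by rewrite vphi vJphi addr0.
rewrite /quadrature mulr_sumr -big_split /=; apply: eq_bigr => k _.
rewrite -mulrDl mulrA; congr (_ * _); case: (v 0 k) => a b.
by apply: complex_ext => /=; ring.
Qed.

(** A rule with the fewest nodes has no null weight, by [drop_null_node], and no
    more than [P] nodes, because a real relation would produce a null weight. *)
Lemma caratheodory D l M (x : 'I_M -> T) w :
  (forall i, exists b : 'I_P -> R[i],
     forall y, D y -> (phi i y)^* = \sum_j b j * phi j y) ->
  nonneg_rule D l x w ->
  exists M' (x' : 'I_M' -> T) (w' : 'I_M' -> R),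
    [/\ (M' <= P)%N, nonneg_rule D l x' w' & forall m, 0 < w' m].
Proof.
move=> conjphi rule.
pose Q n := `[< exists (x : 'I_n -> T) w, nonneg_rule D l x w >].
have exQ : exists n, Q n by exists M; apply/asboolP; exists x, w.
case: (ex_minnP exQ) => n /asboolP[y [u ruleu]] minn {x w rule exQ}.
have nonull (u' : 'I_n -> R) k : nonneg_rule D l y u' -> u' k <> 0.
  case: n => [|n] in y u ruleu minn u' k *; first by case: k.
  move=> ruleu' u'k; have := minn n; rewrite ltnn => /(_ _)/negP[] //.
  apply/asboolP; exists (fun m => y (lift k m)), (fun m => u' (lift k m)).
  exact: drop_null_node.
exists n, y, u; split=> //.
  rewrite leqNgt; apply/negP => Pn; have [Dy _ _] := ruleu.
  have [e epos e0] := real_relation conjphi Dy Pn.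
  have [u' [ruleu' [k u'k]]] := move_along_relation ruleu epos e0.
  exact: nonull ruleu' u'k.
move=> m; rewrite lt_neqAle eq_sym; have [_ -> _] := ruleu.
by rewrite andbT; apply/eqP; exact: nonull.
Qed.

End Caratheodory.

(** * The conjugate closure and its functional *)

Section Spans.
Context (d : measure_display) (T : measurableType d) (R : realType).
Variables (mu : {measure set T -> \bar R}) (D : set T).
Local Notation C := R[i].

Lemma fam_span_mem n (f : 'I_n -> T -> C) i : fam_span D f (f i).
Proof.
exists (fun j => (j == i)%:R) => x _.
rewrite /lin_comb (bigD1 i) //= eqxx mul1r big1 ?addr0 // => j /negbTE ->.
by rewrite mul0r.
Qed.

Lemma fam_span_lin_comb n m (f : 'I_n -> T -> C) (u : 'I_m -> T -> C) c v :
  (forall i, fam_span D f (u i)) -> eq_on D v (lin_comb c u) -> fam_span D f v.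
Proof.
move=> /choice[a ua] vE; exists (fun j => \sum_i c i * a i j) => x Dx.
rewrite vE // /lin_comb; under eq_bigr => i _ do rewrite ua // mulr_sumr.
rewrite exchange_big; apply: eq_bigr => j _ /=.
by rewrite mulr_suml; apply: eq_bigr => i _; rewrite mulrA.
Qed.

Definition with_conj n (f : 'I_n -> T -> C) (k : 'I_(n + n)) : T -> C :=
  match fintype.split k with inl i => f i | inr i => fconj (f i) end.

Lemma conj_closure_with_conj n (f : 'I_n -> T -> C) :
  conj_closure D (fam_span D f) `<=` fam_span D (with_conj f).
Proof.
have memf i : fam_span D (with_conj f) (f i).
  have := fam_span_mem (with_conj f) (lshift n i).
  by rewrite {2}/with_conj (unsplitK (inl i)).
have memfJ i : fam_span D (with_conj f) (fconj (f i)).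
  have := fam_span_mem (with_conj f) (rshift n i).
  by rewrite {2}/with_conj (unsplitK (inr i)).
move=> v [m [c [u [Vu vE]]]]; apply: fam_span_lin_comb vE => i.
have [[a uE]|[v' [a v'E] <-]] := Vu i; first exact: fam_span_lin_comb memf uE.
apply: (fam_span_lin_comb (c := fun j => (a j)^*) memfJ) => x Dx.
rewrite /fconj v'E // /lin_comb rmorph_sum.
by apply: eq_bigr => j _; rewrite rmorphM.
Qed.

Lemma sub_conj_closure (V : set (T -> C)) : V `<=` conj_closure D V.
Proof.
move=> v Vv; exists 1%N, (fun=> 1), (fun=> v); split=> [_|x _]; first by left.
by rewrite /lin_comb big_ord1 mul1r.
Qed.

Hypothesis mD : measurable D.

(** If [m < n], a nonzero [c] in the left kernel of the matrix that expresses
    the [phi i] through the [f j] makes [sum_i c_i phi_i] vanish on [D], whereas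
    its inner products with the [phi k] are the [c k]. *)
Lemma orthonormal_leq n m (phi : 'I_n -> T -> C) (f : 'I_m -> T -> C) :
  (forall i, memL2 mu D (phi i)) ->
  (forall i j, inner mu D (phi i) (phi j) = (i == j)%:R) ->
  (forall i, fam_span D f (phi i)) -> (n <= m)%N.
Proof.
move=> phi2 ortho /choice[a phiE]; rewrite leqNgt; apply/negP => mn.
have [c c0 ca] := left_kernel (\matrix_(i < n, j < m) a i j) mn.
have /rV0Pn[k /eqP[]] := c0.
have <- : inner mu D (phi k) (lin_comb (fun i => c 0 i) phi) = c 0 k.
  rewrite inner_lin_combr // => [|i]; last exact: cintegrable_inner.
  rewrite (bigD1 k) //= ortho eqxx mulr1 big1 ?addr0 // => i ik.
  by rewrite ortho eq_sym (negbTE ik) mulr0.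
have combE x : D x -> lin_comb (fun i => c 0 i) phi x = 0.
  move=> Dx; rewrite /lin_comb.
  under eq_bigr => i _ do rewrite phiE // mulr_sumr.
  rewrite exchange_big big1 // => j _ /=.
  have := congr1 (fun A : 'rV_m => A 0 j) ca; rewrite !mxE => cj.
  under eq_bigr do rewrite mulrA.
  rewrite -mulr_suml (_ : \sum_i _ = 0) ?mul0r // -[RHS]cj.
  by apply: eq_bigr => i _; rewrite mxE.
have -> : inner mu D (phi k) (lin_comb (fun i => c 0 i) phi) =
    inner mu D (phi k) (lin_comb (fun i : 'I_0 => 0) (fun i => phi k)).
  apply: (eq_cint mu) => x Dx.
  by rewrite combE // /lin_comb big_ord0.
by rewrite inner_lin_combr ?big_ord0 // => -[].
Qed.

(** Since [F0] is real and nonnegative, the inner product of [F] with [phi i] is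
    the integral of [phi i] against the positive measure [F0 mu], so
    [tchakaloff] applies to the real and imaginary parts of the [phi i]. *)
Lemma inner_quadrature n (phi : 'I_n -> T -> C) (F F0 : T -> C) :
  (forall i, memL2 mu D (phi i)) -> fam_span D phi F ->
  cmeasurable D F0 ->
  {ae mu, forall x, D x -> F0 x = F x} -> (forall x, D x -> 0 <= F0 x) ->
  exists M (x : 'I_M -> T) (w : 'I_M -> R),
    nonneg_rule phi D (fun i => inner mu D F (phi i)) x w.
Proof.
move=> phi2 spanF mF0 F0F F0_ge0.
pose psi (k : 'I_(n + n)) (x : T) : R := match fintype.split k with
  | inl i => complex.Re (phi i x) | inr i => complex.Im (phi i x) end.
pose g x := complex.Re (F0 x).
have F0E x : D x -> F0 x = (g x)%:C%C.
  by move=> /F0_ge0/ge0_complexE[_ im0]; exact: complex_ext.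
have mphi i : cmeasurable D (phi i) by case: (phi2 i).
pose H i x := (F x)^* * phi i x.
have IH i : cintegrable mu D (H i).
  exact: cintegrable_span_inner (phi2 i).
have mH i : cmeasurable D (H i).
  by have [I1 I2] := IH i; split; apply/measurable_EFinP;
    [exact: measurable_int I1|exact: measurable_int I2].
have mg : measurable_fun D g by case: mF0.
pose Hg i x := (real_complex R (g x)) * phi i x.
have ReHg i x : complex.Re (Hg i x) = g x * complex.Re (phi i x).
  exact: Re_real_mul.
have ImHg i x : complex.Im (Hg i x) = g x * complex.Im (phi i x).
  exact: Im_real_mul.
have mHg i : cmeasurable D (Hg i).
  have [m1 m2] := mphi i; split.
    by under eq_fun do rewrite ReHg; exact: measurable_funM.
  by under eq_fun do rewrite ImHg; exact: measurable_funM.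
have HHg i : {ae mu, forall x, D x -> H i x = Hg i x}.
  move: F0F; apply: filterS => x F0Fx Dx; rewrite /H /Hg -F0Fx // F0E //.
  by congr (_ * _); apply: complex_ext; rewrite ?Re_conj ?Im_conj /= ?oppr0.
have [IHg innerE] : (forall i, cintegrable mu D (Hg i)) /\
    forall i, inner mu D F (phi i) = cint mu D (Hg i).
  split=> i; first exact: ae_eq_cintegrable (IH i).
  exact: (ae_eq_cint mD (mH i) (mHg i) (HHg i)).
have [||k|k|M [x [w [Dx w0 wE]]]] := @tchakaloff _ _ _ mu g _ D psi mD _ _ _ _.
- exact: mg.
- by move=> x /F0_ge0/ge0_complexE[].
- rewrite /psi; case: fintype.split => i; by have [m1 m2] := mphi i.
- rewrite /psi; case: fintype.split => i; have [I1 I2] := IHg i.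
    by under eq_fun do rewrite -ReHg.
  by under eq_fun do rewrite -ImHg.
exists M, x, w; split=> // i; rewrite innerE; apply: complex_ext.
  rewrite Re_sum /=; under eq_bigr do rewrite Re_real_mul.
  under eq_Rintegral do rewrite ReHg.
  by have := wE (lshift n i); rewrite /psi (unsplitK (inl i)).
rewrite Im_sum /=; under eq_bigr do rewrite Im_real_mul.
under eq_Rintegral do rewrite ImHg.
by have := wE (rshift n i); rewrite /psi (unsplitK (inr i)).
Qed.

End Spans.

(** The complement of the support is the union of the open null sets. *)
Lemma closed_support_measurable (R : realType) (X : completeNormedModType R)
    (G : set (set X)) (mu : {measure set (g_sigma_algebraType G) -> \bar R}) :
  [set O : set X | open O] `<=` G -> 
  measurable (closed_support mu : set (g_sigma_algebraType G)).
Proof.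
move=> openG; rewrite -[closed_support mu]setCK; apply: measurableC.
apply: sub_sigma_algebra; apply: openG => /=.
rewrite (_ : ~` _ = \bigcup_(O in [set O : set X | open O /\ mu O = 0%E]) O).
  by apply: bigcup_open => U [].
apply/seteqP; split=> [x /=|x [U [oU muU] Ux] /= /(_ U oU Ux)]; last first.
  by rewrite muU ltxx.
move=> /existsNP[U /not_implyP[oU /not_implyP[Ux muU]]]; exists U => //.
split=> //.
by apply/eqP; rewrite eq_le measure_ge0 andbT leNgt; exact/negP.
Qed.

Theorem theorem2p12 (R : realType) (X : completeNormedModType R)
  (G : set (set X)) (openG : [set O : set X | open O] `<=` G)
  (mu : {measure set (g_sigma_algebraType G) -> \bar R})
  (D : set (g_sigma_algebraType G)) (suppD : D = closed_support mu)
  (N : nat) (V : set (g_sigma_algebraType G -> R[i]))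
  (dimV : L2_subspace_dim mu D N V)
  (L : (g_sigma_algebraType G -> R[i]) -> R[i]) (dualL : in_dual D V L)
  (P : nat) (phi : 'I_P -> g_sigma_algebraType G -> R[i])
  (basis_phi : orthonormal_basis mu D phi (conj_closure D V))
  (Lt : (g_sigma_algebraType G -> R[i]) -> R[i])
  (dualLt : in_dual D (conj_closure D V) Lt)
  (Lt_neq0 : exists2 v, conj_closure D V v & Lt v != 0)
  (LtL : forall v, V v -> Lt v = L v)
  (tau2 : g_sigma_algebraType G -> R)
  (rho : probability (g_sigma_algebraType G) R)
  (sampling : sampling_measure mu D phi tau2 rho)
  (admissible : relatively_admissible mu D phi tau2 rho Lt)
  (nonneg : nonnegative_pair mu D (conj_closure D V) Lt) :
  (P <= 2 * N)%N /\
  exists (M : nat) (x : 'I_M -> g_sigma_algebraType G) (w : 'I_M -> R),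
    [/\ (M <= P)%N,
        forall m, D (x m),
        forall m, 0 < w m,
        forall v, conj_closure D V v -> quadrature x w v = Lt v
      & forall v, V v -> quadrature x w v = L v].
Proof.
have mD : measurable D by rewrite suppD; exact: closed_support_measurable.
have [phi2 ortho UE] := basis_phi.
have memphi i : conj_closure D V (phi i) by rewrite UE; exact: fam_span_mem.
split.
  have [psi [_ _ VE]] := dimV.
  rewrite mul2n -addnn.
  apply: (orthonormal_leq (f := with_conj psi) mD phi2 ortho) => i.
  by apply: conj_closure_with_conj; rewrite -VE.
have [conjU _ [F [F0 [[UF LtF] mF0 F0F F0_ge0]]]] := nonneg.
have spanF : fam_span D phi F by rewrite -UE.
have [M0 [x0 [w0 rule0]]] := inner_quadrature mD phi2 spanF mF0 F0F F0_ge0.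
have conjphi i : exists b : 'I_P -> R[i],
    forall y, D y -> (phi i y)^* = \sum_j b j * phi j y.
  by have := conjU _ (memphi i); rewrite {1}UE.
have [M [x [w [MP [Dx _ wE] w_gt0]]]] := caratheodory conjphi rule0.
have exact_Lt v : conj_closure D V v -> quadrature x w v = Lt v.
  move=> Uv; rewrite (LtF _ Uv).
  have : fam_span D phi v by rewrite -UE.
  move=> [a vE].
  have -> : inner mu D F v = inner mu D F (lin_comb a phi).
    by apply: (eq_cint mu) => y Dy; rewrite vE.
  rewrite inner_lin_combr // => [|i]; last first.
    exact: cintegrable_span_inner (phi2 i).
  rewrite /quadrature; under eq_bigr => m _ do rewrite vE // mulr_sumr.
  rewrite exchange_big; apply: eq_bigr => i _ /=.
  by rewrite -wE mulr_sumr; apply: eq_bigr => m _; rewrite mulrCA.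
exists M, x, w; split=> // v Vv.
by rewrite exact_Lt ?LtL //; exact: sub_conj_closure.
Qed.
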